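(* Suppose that $g\notin\mathrm{Span}\{1,t_1^N,\dots,t^N_{\tilde L^N}\}$ and that $P^N\in\mathcal M^{np,N}$ is nondegenerate. Then the linear programs $\mathrm{Primal}(P^N)$ and $\mathrm{Dual}(P^N)$ have the same value, and $\mathrm{Dual}(P^N)$ admits a unique minimizer $(\lambda,\nu)\in\mathbb R^{\tilde L^N}\times\mathbb R$.
   Context: Write $[m]=\{1,\dots,m\}$. Let $J,T\ge 1$ be integers and $\mathcal A_T=\{A_1\times\cdots\times A_T: \varnothing\neq A_t\subseteq[J]\}$. For an integer $N\ge1$ fix a design $a_1^N,\dots,a_N^N\in\mathcal A_T$, let $\mathcal Y^N=a_1^N\times\cdots\times a_N^N$ and let $\mathcal M^{np,N}$ be the set of all probability measures on the finite set $\mathcal Y^N$. Let $(\mathcal B,\mathscr B)$ be a measurable space and $\mathcal Q_\beta$ the set of all probability measures on it. A choice kernel is a measurable map $s:\mathcal B\times\mathcal A_T\times[J]^T\to[0,1]$ (discrete $\sigma$-algebras on the finite factors) with $s(\beta,a,y)=0$ if $y\notin a$ and $\sum_{y\in a}s(\beta,a,y)=1$ for all $(\beta,a)$; fix one. Let $g:\mathcal B\to[0,1]$ be measurable. Let $\mathcal D^N=\{(a,y):a\in\{a_1^N,\dots,a_N^N\},y\in a\}$, $n_a=\#\{i\in[N]:a_i^N=a\}$, and for $P\in\mathcal M^{np,N}$ let $Q^{np,N}_{Y\mid a}(P)(a,y)=\frac1{n_a}\sum_{i:a_i^N=a}P_i(y)$ where $P_i$ is the $i$-th marginal of $P$. Let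 $L^N=\#\mathcal D^N$, let $(a(l),y(l))_{l\in[L^N]}$ be an ordering of $\mathcal D^N$, $t_l^N(\beta)=s(\beta,a(l),y(l))$. Let $\tilde L^N+1$ be the maximal cardinality of a linearly independent subset of the functions $\{1,t_1^N,\dots,t^N_{L^N}\}$ on $\mathcal B$, with the ordering chosen so that $1,t_1^N,\dots,t^N_{\tilde L^N}$ is such a subset. Put $t^N=(t_1^N,\dots,t^N_{\tilde L^N})^\top$ and $b^N(P)=(Q^{np,N}_{Y\mid a}(P)(a(l),y(l)))_{l=1}^{\tilde L^N}$. $\mathrm{Primal}(P)$: $\sup_{Q_\beta\in\mathcal Q_\beta}\int g\,dQ_\beta$ subject to $\int t_l^N\,dQ_\beta=b_l^N(P)$ for all $l\in[\tilde L^N]$. $\mathrm{Dual}(P)$: $\inf_{\lambda\in\mathbb R^{\tilde L^N},\nu\in\mathbb R}\lambda^\top b^N(P)+\nu$ subject to $\lambda^\top t^N(\beta)+\nu\ge g(\beta)$ for all $\beta\in\mathcal B$. Nondegeneracy: $P$ is nondegenerate if $\mathrm{Primal}(P)$ admits a maximizer of the form $Q=\sum_{l=1}^{\tilde L^N+1}Q_l\delta_{\beta_l}$ with all $Q_l>0$, $\sum_lQ_l=1$, $\beta_1,\dots,\beta_{\tilde L^N+1}\in\mathcal B$, such that the $(\tilde L^N+1)\times(\tilde L^N+1)$ matrix whose $l$-th row, $l\le\tilde L^N$, is $(t_l^N(\beta_k))_{k=1}^{\tilde L^N+1}$ and whose last row is $(1,\dots,1)$ has full rank. *)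

(* Defs.v *)
From HB Require Import structures.
From mathcomp Require Import all_boot all_order all_algebra.
From mathcomp Require Import all_classical all_reals all_analysis.

Set Implicit Arguments.
Unset Strict Implicit.
Unset Printing Implicit Defensive.
Import Order.TTheory GRing.Theory Num.Theory.
Import numFieldNormedType.Exports.
Local Open Scope classical_set_scope.
Local Open Scope ring_scope.

(* The assumptions J, T, N >= 1 are built into the types: the
   parameters J, T, N below stand for J - 1, T - 1, N - 1 of the mathematics, so
   there are J.+1 alternatives, T.+1 periods and N.+1 individuals.  Indices start
   at 0. *)

(* The elements of [J]^T. *)
Definition history (J T : nat) : Type := {ffun 'I_T.+1 -> 'I_J.+1}.

HB.instance Definition _ J T := Finite.on (history J T).
HB.instance Definition _ J T :=
  isPointed.Build (history J T) [ffun=> ord0].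
HB.instance Definition _ J T :=
  @isMeasurable.Build default_measure_display (history J T)
    discrete_measurable discrete_measurable0
    discrete_measurableC discrete_measurableU.

Definition history_box J T (C : {ffun 'I_T.+1 -> {set 'I_J.+1}}) :
    {set history J T} :=
  [set y : history J T | [forall t, y t \in C t]]%SET.

(* The collection A_T of products A_1 x ... x A_T of nonempty sets. *)
Definition menus (J T : nat) : {set {set history J T}} :=
  [set history_box C | C : {ffun 'I_T.+1 -> {set 'I_J.+1}}
                     & [forall t, C t != finset.set0]]%SET.

Record menu (J T : nat) : Type := Menu {
  menu_set :> {set history J T} ;
  menu_setP : menu_set \in menus J T }.

HB.instance Definition _ J T := [isSub for @menu_set J T].
HB.instance Definition _ J T := [Finite of menu J T by <:].

Fact full_menu_subproof J T :
  history_box [ffun=> finset.setT] \in menus J T.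
Proof.
apply/imsetP; exists [ffun=> finset.setT] => //; rewrite inE.
by apply/forallP => t; rewrite ffunE; apply/set0Pn; exists ord0; rewrite finset.in_setT.
Qed.

HB.instance Definition _ J T :=
  isPointed.Build (menu J T) (Menu (full_menu_subproof J T)).
HB.instance Definition _ J T :=
  @isMeasurable.Build default_measure_display (menu J T)
    discrete_measurable discrete_measurable0
    discrete_measurableC discrete_measurableU.

(* [outcome a] is the finite set Y^N = a_1 x ... x a_N, with its discrete
   sigma-algebra; the set of probability measures on it is
   [probability (outcome a) R]. *)
Definition is_outcome J T N (a : 'I_N.+1 -> menu J T) :
    pred {ffun 'I_N.+1 -> history J T} :=
  fun w => [forall i, w i \in menu_set (a i)].

Definition outcome J T N (a : 'I_N.+1 -> menu J T) : Type :=
  {w | is_outcome a w}.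

Fact menu_neq0 J T (m : menu J T) : exists y, y \in menu_set m.
Proof.
case: m => _ /= /imsetP[C /[!inE]/forallP C0 ->].
exists [ffun t => xchoose (set0Pn _ (C0 t))].
by rewrite inE; apply/forallP => t; rewrite ffunE; exact: xchooseP.
Qed.

Fact outcome_subproof J T N (a : 'I_N.+1 -> menu J T) :
  is_outcome a [ffun i => xchoose (menu_neq0 (a i))].
Proof. by apply/forallP => i; rewrite ffunE; exact: xchooseP. Qed.

Definition outcome_point J T N (a : 'I_N.+1 -> menu J T) : outcome a :=
  exist (is_outcome a) _ (outcome_subproof a).

HB.instance Definition _ J T N (a : 'I_N.+1 -> menu J T) :=
  Finite.on (outcome a).
HB.instance Definition _ J T N (a : 'I_N.+1 -> menu J T) :=
  isPointed.Build (outcome a) (outcome_point a).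
HB.instance Definition _ J T N (a : 'I_N.+1 -> menu J T) :=
  @isMeasurable.Build default_measure_display (outcome a)
    discrete_measurable discrete_measurable0
    discrete_measurableC discrete_measurableU.

Definition coordinate J T N (a : 'I_N.+1 -> menu J T) (i : 'I_N.+1) :
    outcome a -> history J T :=
  fun w => val w i.

Definition marginal (R : realType) J T N (a : 'I_N.+1 -> menu J T)
    (P : probability (outcome a) R) (i : 'I_N.+1) : set (history J T) -> \bar R :=
  pushforward P (@coordinate J T N a i).

(* The pairs (m, y) of a menu m occurring in the design and a choice y in m. *)
Definition data J T N (a : 'I_N.+1 -> menu J T) :
    {set menu J T * history J T} :=
  [set my : menu J T * history J T
    | (my.1 \in codom a) && (my.2 \in menu_set my.1)]%SET.

Definition menu_count J T N (a : 'I_N.+1 -> menu J T) (m : menu J T) : nat :=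
  #|[set i | a i == m]%SET|.

Definition avg_choice_prob (R : realType) J T N (a : 'I_N.+1 -> menu J T)
    (P : probability (outcome a) R) (m : menu J T) (y : history J T) : R :=
  (menu_count a m)%:R^-1 *
    \sum_(i < N.+1 | a i == m) fine (marginal P i [set y]).

Record choice_kernel (d : measure_display) (B : measurableType d) (R : realType)
    (J T : nat) : Type := ChoiceKernel {
  ck_fun :> B -> menu J T -> history J T -> R ;
  ck_measurable : measurable_fun [set: B * menu J T * history J T]
    (fun x => ck_fun x.1.1 x.1.2 x.2) ;
  ck_itv : forall b m y, 0 <= ck_fun b m y <= 1 ;
  ck_out : forall b m y, y \notin menu_set m -> ck_fun b m y = 0 ;
  ck_sum : forall b m, \sum_(y in menu_set m) ck_fun b m y = 1 }.

Definition lin_indep (B : Type) (R : realType) (S : set (B -> R)) : Prop :=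
  forall (n : nat) (f : 'I_n -> B -> R) (c : 'I_n -> R),
    injective f -> (forall i, S (f i)) ->
    (forall b, \sum_(i < n) c i * f i b = 0) -> forall i, c i = 0.

Definition lin_span (B : Type) (R : realType) (S : set (B -> R)) : set (B -> R) :=
  [set h | exists (n : nat) (f : 'I_n -> B -> R) (c : 'I_n -> R),
    (forall i, S (f i)) /\ forall b, h b = \sum_(i < n) c i * f i b].

Definition max_indep_card (B : Type) (R : realType) (F : set (B -> R))
    (n : nat) : Prop :=
  (exists S, [/\ S `<=` F, lin_indep S & (S #= `I_n)%card]) /\
  forall (S : set (B -> R)) (m : nat),
    S `<=` F -> lin_indep S -> (S #= `I_m)%card -> (m <= n)%N.

Section programs.
Context (R : realType) (J T N : nat) (a : 'I_N.+1 -> menu J T).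
Context (d : measure_display) (B : measurableType d).
Context (s : choice_kernel B R J T) (g : B -> R).
Variable e : #|data a|.-tuple (menu J T * history J T).

(* The default value of [nth] is never reached when l < #|data a|. *)
Definition choice_fun (l : nat) : B -> R :=
  fun b => s b (nth point e l).1 (nth point e l).2.

(* The constant 1 and the first m choice functions, as a set: functions that
   coincide count once. *)
Definition choice_funs (m : nat) : set (B -> R) :=
  [set cst 1] `|` [set choice_fun l | l in `I_m].

(* L is the number of moment constraints: the rank of {1, t_1, ...} minus one. *)
Definition tvec (L : nat) (b : B) : 'cV[R]_L := \col_l choice_fun l b.

Definition bvec (L : nat) (P : probability (outcome a) R) : 'cV[R]_L :=
  \col_l avg_choice_prob P (nth point e l).1 (nth point e l).2.

Definition primal_feasible (L : nat) (P : probability (outcome a) R) :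
    set (probability B R) :=
  [set Q | forall l : 'I_L,
     (\int[Q]_b (tvec L b l 0)%:E = (bvec L P l 0)%:E)%E].

Definition primal_obj (Q : probability B R) : \bar R := (\int[Q]_b (g b)%:E)%E.

Definition primal_value (L : nat) (P : probability (outcome a) R) : \bar R :=
  ereal_sup [set primal_obj Q | Q in primal_feasible L P].

Definition primal_maximizer (L : nat) (P : probability (outcome a) R)
    (Q : probability B R) : Prop :=
  primal_feasible L P Q /\
  forall Q', primal_feasible L P Q' -> (primal_obj Q' <= primal_obj Q)%E.

(* The pairs x = (lambda, nu). *)
Definition dual_feasible (L : nat) : set ('cV[R]_L * R) :=
  [set x | forall b, g b <= (x.1^T *m tvec L b) 0 0 + x.2].

Definition dual_obj (L : nat) (P : probability (outcome a) R)
    (x : 'cV[R]_L * R) : R :=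
  (x.1^T *m bvec L P) 0 0 + x.2.

Definition dual_value (L : nat) (P : probability (outcome a) R) : \bar R :=
  ereal_inf [set (dual_obj P x)%:E | x in @dual_feasible L].

Definition dual_minimizer (L : nat) (P : probability (outcome a) R)
    (x : 'cV[R]_L * R) : Prop :=
  dual_feasible x /\
  forall x', @dual_feasible L x' -> dual_obj P x <= dual_obj P x'.

Definition moment_matrix (L : nat) (beta : 'I_(L + 1) -> B) : 'M[R]_(L + 1) :=
  col_mx (\matrix_(l < L, k < L + 1) tvec L (beta k) l 0) (const_mx 1).

Definition nondegenerate_distribution (L : nat) (P : probability (outcome a) R) : Prop :=
  exists (q : 'I_(L + 1) -> R) (beta : 'I_(L + 1) -> B) (Q : probability B R),
    [/\ (forall k, 0 < q k) /\ \sum_k q k = 1,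
        forall A, measurable A ->
          (Q A = \sum_k (q k)%:E * \d_(beta k) A)%E,
        primal_maximizer L P Q
      & \rank (moment_matrix beta) = (L + 1)%N].

End programs.

(* Main.v *)
Require Import Defs.
From HB Require Import structures.
From mathcomp Require Import all_boot all_order all_algebra.
From mathcomp Require Import all_classical all_reals all_analysis.
From mathcomp Require Import measurable_realfun.

(* At a nondegenerate P the matrix of moments at the atoms beta_k of the optimal
   Q is invertible, so there is exactly one (lambda, nu) whose affine form
   lambda^T t + nu agrees with g at every beta_k.  It is dual feasible: any
   (t(b), 1) is a combination of the (t(beta_k), 1), with coefficients c_k of
   sum 1, so Q + eps (delta_b - sum_k c_k delta_(beta_k)) is primal feasible for
   small eps > 0, and optimality of Q yields g(b) <= sum_k c_k g(beta_k).  The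
   dual objective is the average of the affine form over the atoms with the
   weights of Q; these being positive, a dual feasible pair attains the primal
   value only if it agrees with g at all of them. *)

Set Implicit Arguments.
Unset Strict Implicit.
Unset Printing Implicit Defensive.
Import Order.TTheory GRing.Theory Num.Theory.
Import numFieldNormedType.Exports.
Local Open Scope classical_set_scope.
Local Open Scope ring_scope.

Section discrete_probability.
Context (R : realType) (d : measure_display) (B : measurableType d).

(* [msum] takes a nat-indexed family, hence the default values past n. *)
Definition weighted_diracs n (w : 'I_n -> R) (p : 'I_n -> B)
    (w0 : forall k, 0 <= w k) : {measure set B -> \bar R} :=
  msum (fun k => mscale (oapp (fun i => NngNum (w0 i)) 0%:nng (insub k))
                        \d_(oapp p point (insub k))) n.

Lemma weighted_diracsE n (w : 'I_n -> R) (p : 'I_n -> B)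
    (w0 : forall k, 0 <= w k) A :
  (weighted_diracs p w0 A = \sum_k (w k)%:E * \d_(p k) A)%E.
Proof. by rewrite /= /msum; apply: eq_bigr => k _; rewrite /mscale/= valK. Qed.

Lemma exists_discrete_probability n (w : 'I_n -> R) (p : 'I_n -> B) :
    (forall k, 0 <= w k) -> \sum_k w k = 1 ->
  exists Q : probability B R, forall A,
    (Q A = \sum_k (w k)%:E * \d_(p k) A)%E.
Proof.
move=> w0 w1; have Q1 : weighted_diracs p w0 setT = 1%E.
  rewrite weighted_diracsE -[1%E]/(1%:E) -w1 -sumEFin.
  by apply: eq_bigr => k _; rewrite diracT mule1.
pose Q : probability B R :=
  HB.pack_for (probability B R) (Measure.sort (weighted_diracs p w0))
    (Measure_isProbability.Build _ _ _ (weighted_diracs p w0) Q1).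
by exists Q => A; rewrite -(weighted_diracsE p w0).
Qed.

(** The formula for [Q] is asked on measurable sets only, which is all that nondegeneracy provides.
    As [f] is nonnegative, its integral splits over the sum of Dirac masses with no integrability
    condition. *)
Lemma ge0_integral_discrete n (w : 'I_n -> R) (p : 'I_n -> B)
    (Q : {measure set B -> \bar R}) (f : B -> R) :
    (forall k, 0 <= w k) ->
    (forall A, measurable A -> Q A = \sum_k (w k)%:E * \d_(p k) A)%E ->
    measurable_fun [set: B] f -> (forall b, 0 <= f b) ->
  (\int[Q]_b (f b)%:E = (\sum_k w k * f (p k))%:E)%E.
Proof.
move=> w0 QE mf f0.
rewrite (eq_measure_integral (weighted_diracs p w0)); last first.
  by move=> A mA _; rewrite weighted_diracsE QE.
rewrite ge0_integral_measure_sum//; last 2 first.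
- by move=> b _; rewrite lee_fin.
- exact/measurable_EFinP.
rewrite -sumEFin; apply: eq_bigr => k _.
rewrite ge0_integral_mscale//; last 2 first.
- exact/measurable_EFinP.
- by move=> b _; rewrite lee_fin.
rewrite integral_dirac//; last exact/measurable_EFinP.
by rewrite diracT mul1e valK EFinM.
Qed.

End discrete_probability.

Section affine_frame.
Context (F : fieldType) (n : nat).
Implicit Types (u : 'I_(n + 1) -> 'cV[F]_n) (x : 'cV[F]_n * F).

Definition affine_form x (v : 'cV[F]_n) : F := (x.1^T *m v) 0 0 + x.2.

(** Column k is the point [u k] with a 1 appended, so invertibility means that the n + 1 points are
    affinely independent. *)
Definition homogeneous_mx u : 'M[F]_(n + 1) :=
  col_mx (\matrix_(l < n, k < n + 1) u k l 0) (const_mx 1).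

Lemma affine_form_sum m (w : 'I_m -> F) (v : 'I_m -> 'cV[F]_n) x :
  \sum_k w k = 1 ->
  affine_form x (\sum_k w k *: v k) = \sum_k w k * affine_form x (v k).
Proof.
move=> w1; rewrite /affine_form mulmx_sumr summxE.
under [RHS]eq_bigr do rewrite mulrDr.
rewrite big_split/= -mulr_suml w1 mul1r; congr (_ + _).
by apply: eq_bigr => k _; rewrite -scalemxAr mxE.
Qed.

(** Solve M c = (v, 1), with M the homogeneous matrix: its last row says that the weights sum to 1,
    the other rows that they represent [v]. *)
Lemma barycentric_coordinates u (v : 'cV[F]_n) :
  homogeneous_mx u \in unitmx ->
  exists2 w : 'I_(n + 1) -> F, \sum_k w k = 1 & v = \sum_k w k *: u k.
Proof.
move=> uU.
have [c] : exists c : 'cV_(n + 1),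
    homogeneous_mx u *m c = col_mx v (const_mx 1).
  exists (invmx (homogeneous_mx u) *m col_mx v (const_mx 1)).
  by rewrite mulKVmx.
rewrite mul_col_mx => /eq_col_mx[cv c1]; exists (fun k => c k 0).
  move/matrixP/(_ 0 0): c1; rewrite !mxE => <-.
  by apply: eq_bigr => k _; rewrite mxE mul1r.
rewrite -cv; apply/colP => l; rewrite mxE summxE.
by apply: eq_bigr => k _; rewrite !mxE mulrC.
Qed.

Lemma mul_homogeneous_mx u x k :
  (row_mx x.1^T x.2%:M *m homogeneous_mx u) 0 k = affine_form x (u k).
Proof.
rewrite /affine_form mul_row_col !mxE big_ord1 !mxE mulr1; congr (_ + _).
by apply: eq_bigr => l _; rewrite !mxE.
Qed.

(** The row (lambda^T, nu) times the homogeneous matrix lists the values of the affine form at the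
    [u k], so interpolation is an invertible linear system. *)
Lemma affine_interpolation u (y : 'I_(n + 1) -> F) :
  homogeneous_mx u \in unitmx ->
  exists! x, forall k, affine_form x (u k) = y k.
Proof.
move=> uU; pose r := (\row_k y k) *m invmx (homogeneous_mx u).
exists ((lsubmx r)^T, rsubmx r 0 0); split=> [k|x xy].
  by rewrite -mul_homogeneous_mx/= trmxK -mx11_scalar hsubmxK mulmxKV// mxE.
have : row_mx x.1^T x.2%:M = r.
  apply: (can_inj (mulmxK uU)); rewrite mulmxKV//; apply/rowP => k.
  by rewrite mul_homogeneous_mx xy mxE.
move=> <-; rewrite row_mxKl row_mxKr trmxK mxE eqxx mulr1n.
by case: {xy} x.
Qed.

End affine_frame.

Lemma small_perturbation (R : realFieldType) n (q c : 'I_n -> R) :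
  (* Each |c_k| / q_k is at most S, so 1 / S works; the summand 1 keeps S positive when every c_k is
     0. *)
  (forall k, 0 < q k) ->
  exists2 eps, 0 < eps & forall k, eps * c k <= q k.
Proof.
move=> q0; pose S := 1 + \sum_k `|c k| / q k.
have cq0 k : 0 <= `|c k| / q k by rewrite divr_ge0// ltW.
have S0 : 0 < S by rewrite ltr_pwDl// sumr_ge0.
exists S^-1 => [|k]; first by rewrite invr_gt0.
rewrite ler_pdivrMl// (le_trans (ler_norm _))// -ler_pdivrMr//.
by rewrite /S (bigD1 k)//= addrCA lerDl addr_ge0// sumr_ge0.
Qed.

Section choice_functions.
Context (R : realType) (J T N : nat) (a : 'I_N.+1 -> menu J T).
Context (d : measure_display) (B : measurableType d).
Context (s : choice_kernel B R J T).
Context (e : #|data a|.-tuple (menu J T * history J T)).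

Lemma choice_fun_ge0 l b : 0 <= choice_fun s e l b.
Proof.
by have /andP[] := ck_itv s b (nth point e l).1 (nth point e l).2.
Qed.

Lemma measurable_choice_fun l : measurable_fun [set: B] (choice_fun s e l).
Proof.
have := measurable_fun_pair1 (nth point e l).2 (ck_measurable s).
exact: (measurable_fun_pair1 (nth point e l).1).
Qed.

End choice_functions.

Theorem proposition1 (R : realType) (J T N : nat) (a : 'I_N.+1 -> menu J T)
    (d : measure_display) (B : measurableType d) (s : choice_kernel B R J T)
    (g : B -> R) (mg : measurable_fun [set: B] g) (g01 : forall b, 0 <= g b <= 1)
    (e : #|data a|.-tuple (menu J T * history J T))
    (e_ordering : perm_eq e (enum (data a)))
    (L : nat)
    (L_max : max_indep_card (choice_funs s e #|data a|) L.+1)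
    (L_indep : lin_indep (choice_funs s e L))
    (L_card : (choice_funs s e L #= `I_L.+1)%card)
    (P : probability (outcome a) R)
    (g_span : ~ lin_span (choice_funs s e L) g)
    (P_nondeg : nondegenerate_distribution s g e L P) :
  primal_value s g e L P = dual_value s g e L P /\
  exists! x : 'cV[R]_L * R, dual_minimizer s g e P x.
Proof.
have [q [beta [Q [[q0 q1] QE [Qfeas Qmax] rkM]]]] := P_nondeg.
have g0 b : 0 <= g b by case/andP: (g01 b).
have MU : homogeneous_mx (fun k => tvec s e L (beta k)) \in unitmx.
  (* By conversion this matrix is [moment_matrix beta], whose rank is [rkM]. *)
  by rewrite -row_free_unit; apply/eqP.
have momentE n (w : 'I_n -> R) (p : 'I_n -> B) (Q' : probability B R)
    (l : 'I_L) :
    (forall k, 0 <= w k) ->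
    (forall A, measurable A -> Q' A = \sum_k (w k)%:E * \d_(p k) A)%E ->
  (\int[Q']_b (tvec s e L b l 0)%:E =
     ((\sum_k w k *: tvec s e L (p k)) l 0)%:E)%E.
  move=> w0 Q'E; under eq_integral do rewrite mxE.
  rewrite (ge0_integral_discrete w0 Q'E (measurable_choice_fun s e l)).
    by rewrite summxE; congr EFin; apply: eq_bigr => k _; rewrite !mxE.
  exact: choice_fun_ge0.
have bE : bvec e L P = \sum_k q k *: tvec s e L (beta k).
  apply/colP => l; apply: EFin_inj; rewrite -Qfeas.
  by apply: momentE => // k; exact: ltW.
have QobjE : primal_obj g Q = (\sum_k q k * g (beta k))%:E.
  by apply: ge0_integral_discrete => // k; exact: ltW.
have dual_objE (x : 'cV[R]_L * R) :
    dual_obj e P x = \sum_k q k * affine_form x (tvec s e L (beta k)).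
  by rewrite -affine_form_sum// -bE.
have [x [xg x_uniq]] := affine_interpolation (g \o beta) MU.
have x_obj : dual_obj e P x = \sum_k q k * g (beta k).
  by rewrite dual_objE; apply: eq_bigr => k _; rewrite xg.
have x_feas : dual_feasible s g e x.
  move=> b; rewrite -[leRHS]/(affine_form x (tvec s e L b)).
  have [c c1 bc] := barycentric_coordinates (tvec s e L b) MU.
  rewrite bc affine_form_sum//; under eq_bigr do rewrite xg/=.
  have [eps eps0 epsq] := small_perturbation c q0.
  (* Weights and atoms of Q + eps (delta_b - sum_k c_k delta_(beta_k)), with b at
     index [ord0]. *)
  pose w k := oapp (fun i => q i - eps * c i) eps (unlift ord0 k).
  pose p k := oapp beta b (unlift ord0 k).
  (* Module-valued [f] lets one identity serve three times: the constant 1 gives the total mass,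
     [tvec] the moments and [g] the objective. *)
  have wpE (V : lmodType R) (f : B -> V) : \sum_k w k *: f (p k) =
      \sum_k q k *: f (beta k) + eps *: (f b - \sum_k c k *: f (beta k)).
    rewrite big_ord_recl /w /p unlift_none/=.
    under eq_bigr do rewrite liftK/= scalerBl -scalerA.
    by rewrite sumrB -scaler_sumr scalerBr addrCA.
  have w0 k : 0 <= w k.
    by rewrite /w; case: unliftP => [i _|_]/=; rewrite ?subr_ge0// ltW.
  have w1 : \sum_k w k = 1.
    have := wpE R^o (cst 1); rewrite /cst.
    under eq_bigr do rewrite /GRing.scale/= mulr1.
    under [in RHS]eq_bigr do rewrite /GRing.scale/= mulr1.
    under [X in _ - X]eq_bigr do rewrite /GRing.scale/= mulr1.
    by rewrite q1 c1 subrr scaler0 addr0.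
  have [Q' Q'E] := exists_discrete_probability p w0 w1.
  have : (primal_obj g Q' <= primal_obj g Q)%E.
    apply: Qmax => l; rewrite (momentE _ _ _ _ _ w0 (fun A _ => Q'E A)).
    by rewrite wpE -bc subrr scaler0 addr0 -bE.
  rewrite QobjE /primal_obj (ge0_integral_discrete w0 (fun A _ => Q'E A))//.
  rewrite lee_fin; have /= -> := wpE R^o g.
  by rewrite gerDl pmulr_rle0// subr_le0.
(* Weak duality: average the dual constraints at the atoms with the weights [q k]. *)
have dual_ge (x' : 'cV[R]_L * R) : dual_feasible s g e x' ->
    \sum_k q k * g (beta k) <= dual_obj e P x'.
  move=> x'_feas; rewrite dual_objE; apply: ler_sum => k _.
  by rewrite ler_pM2l//; exact: x'_feas.
split.
  apply/eqP; rewrite eq_le; apply/andP; split.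
    apply: ge_ereal_sup => _ [Q' Q'feas <-].
    apply: le_ereal_inf_tmp => _ [x' x'_feas <-].
    by rewrite (le_trans (Qmax _ Q'feas))// QobjE lee_fin dual_ge.
  rewrite (@le_trans _ _ (dual_obj e P x)%:E)//.
    by apply: ereal_inf_lbound; exists x.
  by rewrite x_obj -QobjE; apply: ereal_sup_ubound; exists Q.
exists x; split.
  by split=> // x' x'_feas; rewrite x_obj dual_ge.
move=> x' [x'_feas x'_min]; apply: x_uniq => k.
(* Complementary slackness: [x'] does no worse than [x], so its weighted slacks at the atoms sum to
   0; each is nonnegative, hence 0. *)
have /eqP : \sum_k q k * (affine_form x' (tvec s e L (beta k)) - g (beta k)) = 0.
  under eq_bigr do rewrite mulrBr.
  rewrite sumrB -dual_objE; apply/eqP; rewrite subr_eq0 eq_le dual_ge// andbT.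
  by rewrite -x_obj x'_min.
rewrite psumr_eq0 => [/allP/(_ k)|i _]; last first.
  by rewrite mulr_ge0 ?(ltW (q0 i))// subr_ge0; exact: x'_feas.
by rewrite mem_index_enum mulf_eq0 gt_eqF//= subr_eq0 => /(_ isT)/eqP.
Qed.
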